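(* For every integer $k\ge 2$ there exists a universal cycle of the set of all naturally labeled posets of size $k$.
   Context: A naturally labeled poset (NL poset) of size $k$ is a partial order $\prec$ on the label set $[k]=\{1,2,\ldots,k\}$ such that $a\prec b$ implies $a<b$ as integers. Two NL posets of size $k$ are the same if and only if they are equal as partial orders on $[k]$ (they are not identified up to isomorphism). Let $NL(k)$ denote the number of NL posets of size $k$. For an NL poset $\lambda$ of size $k\ge 2$, let $\lambda^{-}$ be the NL poset of size $k-1$ obtained by restricting $\lambda$ to $\{1,\ldots,k-1\}$ (removing the node with the largest label). Let $\lambda^{+}$ be the NL poset of size $k-1$ obtained by restricting $\lambda$ to $\{2,\ldots,k\}$ (removing the node with the smallest label) and then renumbering the nodes by $i\mapsto i-1$. A universal cycle (u-cycle) of the NL posets of size $k$ is a cyclic ordering $\lambda_1,\lambda_2,\ldots,\lambda_N$ of all NL posets of size $k$, each occurring exactly once (so $N=NL(k)$), such that $\lambda_i^{+}=\lambda_{i+1}^{-}$ for all $i=1,\ldots,N$, where $\lambda_{N+1}=\lambda_1$. That is, one passes from each poset to the next by dropping the node with the smallest label, renumbering the remaining nodes in an order-preserving way, and adding a new node with the largest label. *)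

(* Defs.v *)
From HB Require Import structures.
From mathcomp Require Import all_boot.

Set Implicit Arguments.
Unset Strict Implicit.
Unset Printing Implicit Defensive.

(* The label set [k] = {1, ..., k} is represented by 'I_k = {0, ..., k - 1},
   the label i being encoded by i - 1.  A binary relation on the labels is the
   finite set of its pairs, so that equality of relations is extensional. *)
Definition label_rel (k : nat) (r : {set 'I_k * 'I_k}) : rel 'I_k :=
  fun a b => (a, b) \in r.

(* Strict partial orders on the labels for which a precedes b only if a < b.
   Irreflexivity follows from the last clause; it is kept as part of the
   definition of a strict order. *)
Definition is_nlposet (k : nat) (r : {set 'I_k * 'I_k}) : bool :=
  [&& [forall a, ~~ label_rel r a a],
      [forall b, forall a, forall c,
         label_rel r a b ==> label_rel r b c ==> label_rel r a c]
    & [forall a : 'I_k, forall b : 'I_k, label_rel r a b ==> (a < b)]].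

Lemma is_nlposetP (k : nat) (r : {set 'I_k * 'I_k}) :
  reflect [/\ irreflexive (label_rel r), transitive (label_rel r)
            & forall a b : 'I_k, label_rel r a b -> a < b]
          (is_nlposet r).
Proof.
apply: (iffP and3P) => -[irr tr nat_r]; split.
- by move=> a; apply/negbTE/(forallP irr).
- move=> b a c ab bc.
  by move: (forallP (forallP (forallP tr b) a) c); rewrite ab bc.
- by move=> a b ab; move: (forallP (forallP nat_r a) b); rewrite ab.
- by apply/forallP => a; rewrite irr.
- apply/forallP => b; apply/forallP => a; apply/forallP => c.
  by apply/implyP => ab; apply/implyP; apply: tr ab.
- by apply/forallP => a; apply/forallP => b; apply/implyP/nat_r.
Qed.

Record nlposet (k : nat) := NLPoset {
  nlset : {set 'I_k * 'I_k};
  nlsetP : is_nlposet nlset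
}.

HB.instance Definition _ (k : nat) := [isSub for @nlset k].
HB.instance Definition _ (k : nat) := [Countable of nlposet k by <:].
HB.instance Definition _ (k : nat) := [Finite of nlposet k by <:].

Definition prec (k : nat) (p : nlposet k) : rel 'I_k := label_rel (nlset p).

Lemma restrict_subproof (m k : nat) (f : 'I_m -> 'I_k) (p : nlposet k) :
  {mono f : a b / a < b} ->
  is_nlposet [set ab : 'I_m * 'I_m | prec p (f ab.1) (f ab.2)].
Proof.
move=> f_mono; have /is_nlposetP[irr tr nat_p] := nlsetP p.
apply/is_nlposetP; rewrite /label_rel; split.
- by move=> a; rewrite inE; apply: irr.
- by move=> b a c; rewrite !inE; apply: tr.
- by move=> a b; rewrite inE => /nat_p; rewrite f_mono.
Qed.

(* The restriction of p to the image of the increasing map f, renumbered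
   along f. *)
Definition restrict (m k : nat) (f : 'I_m -> 'I_k)
    (f_mono : {mono f : a b / a < b}) (p : nlposet k) : nlposet m :=
  NLPoset (restrict_subproof p f_mono).

(* For k = 0 the source 'I_k.-1 of the next two maps is empty. *)
Definition keep_low (k : nat) (i : 'I_k.-1) : 'I_k :=
  widen_ord (leq_pred k) i.

Lemma keep_high_subproof (k : nat) (i : 'I_k.-1) : i.+1 < k.
Proof. by rewrite -ltn_predRL. Qed.

Definition keep_high (k : nat) (i : 'I_k.-1) : 'I_k :=
  Ordinal (keep_high_subproof i).

Lemma keep_low_mono (k : nat) : {mono @keep_low k : a b / a < b}.
Proof. by []. Qed.

Lemma keep_high_mono (k : nat) : {mono @keep_high k : a b / a < b}.
Proof. by []. Qed.

(* lambda^- *)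
Definition drop_largest (k : nat) : nlposet k -> nlposet k.-1 :=
  restrict (@keep_low_mono k).

(* lambda^+ *)
Definition drop_smallest (k : nat) : nlposet k -> nlposet k.-1 :=
  restrict (@keep_high_mono k).

(* [path.cycle] includes the wrap-around step from the last item of s to the
   first one. *)
Definition universal_cycle (k : nat) (s : seq (nlposet k)) : Prop :=
  [/\ uniq s, forall p : nlposet k, p \in s
    & cycle (fun p q => drop_smallest p == drop_largest q) s].

(* Main.v *)
Require Import Defs.
From mathcomp Require Import all_boot.
From mathcomp Require Import fingroup perm.

Set Implicit Arguments.
Unset Strict Implicit.
Unset Printing Implicit Defensive.

(** View each poset p of size k as an arc from p^- to p^+ in a directed
multigraph whose vertices are the posets of size k - 1; a universal cycle is
then an Eulerian circuit, so it suffices that this multigraph is balanced and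
connected.

Balance is witnessed by an explicit permutation of the arcs.  Given p with
smallest label x, the labels of p^+ that are not above x form a down-set of
p^+, because those above x form an up-set.  [replace_smallest] removes x and
adds a new largest label above exactly this down-set.  The result starts at the
vertex where p ends, and p can be recovered from it ([replace_smallest_inj]).

Connectedness is directed reachability of the antichain: repeatedly dropping
the smallest label and adding an isolated largest one eventually erases every
relation ([connect_antichain]).

The existence of an Eulerian circuit ([eulerian_circuit]) is also argued with
permutations.  A permutation s of the arcs such that [s e] starts where [e]
ends splits the arcs into closed trails, the orbits of s.  If two distinct
orbits met at a vertex, composing s with a transposition would join them;
hence, when s has as few orbits as possible, arcs ending at the same vertex lie
in the same orbit, and connectedness leaves a single orbit. *)

(** * Eulerian circuits from permutations of the arcs *)

Section Eulerian.

Variables (T : finType) (V : eqType) (src tgt : T -> V).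

Let follows : rel T := fun e f => tgt e == src f.

Definition is_routing (s : {perm T}) : bool := [forall e, follows e (s e)].

Lemma is_routing_tperm (s : {perm T}) (e f : T) :
  is_routing s -> tgt e = tgt f -> is_routing (tperm e f * s)%g.
Proof.
move=> /forallP s_ok eq_ef; apply/forallP => g; rewrite permM.
have -> : follows g = follows (tperm e f g).
  by rewrite /follows; case: tpermP => [->|->|]; rewrite ?eq_ef.
exact: s_ok.
Qed.

(** Otherwise the two orbits would be merged by exchanging the successors of
[e] and [f], which start at the same vertex because [e] and [f] end there. *)
Lemma min_routing_porbit (s : {perm T}) :
    is_routing s ->
    (forall s', is_routing s' -> #|porbits s| <= #|porbits s'|) ->
  forall e f, tgt e = tgt f -> e \in porbit s f.
Proof.
move=> s_ok s_min e f eq_ef; apply/negPn/negP => ef'.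
have ne_ef : e != f by apply: contraNneq ef' => ->; apply: porbit_id.
have := porbits_mul_tperm s e f; rewrite /= ef' ne_ef addn2 addn1 => -[merged].
by have := s_min _ (is_routing_tperm s_ok eq_ef); rewrite -merged ltnn.
Qed.

(** The existence of [s0] says that the multigraph is balanced.  An orbit of a
routing with the fewest orbits is closed under [follows], so the orbit of [e0]
contains every arc from which [e0] can be reached. *)
Lemma eulerian_circuit (s0 : {perm T}) (e0 : T) :
    is_routing s0 -> (forall e, connect follows e e0) ->
  exists s : seq T, [/\ uniq s, forall e, e \in s & path.cycle follows s].
Proof.
move=> s0_ok to_e0.
case: (arg_minnP (fun s : {perm T} => #|porbits s|) s0_ok) => s s_ok s_min.
have s_step e : src (s e) = tgt e by apply/esym/eqP/(forallP s_ok).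
have same_orbit e f : follows e f -> porbit s e = porbit s f.
  move/eqP=> ef; apply/eqP; rewrite eq_porbit_mem.
  (* e and s^-1 f both end where f starts. *)
  have -> : porbit s f = porbit s ((s^-1)%g f).
    apply/eqP; rewrite eq_porbit_mem -{1}(permKV s f).
    exact: (mem_porbit s 1).
  apply: (min_routing_porbit s_ok s_min).
  by rewrite -(s_step (s^-1 f)%g) permKV.
have one_orbit e : e \in porbit s e0.
  rewrite -eq_porbit_mem; have /connectP[p] := to_e0 e.
  elim: p e => [|f p IH] e /= => [_ -> //|/andP[ef fp] e0E].
  by rewrite (same_orbit _ _ ef) IH.
exists (orbit s e0); split; first exact: orbit_uniq.
- move=> e; rewrite -fconnect_orbit.
  by have /porbitP[i ->] := one_orbit e; rewrite permX fconnect_iter.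
- apply: sub_cycle (cycle_orbit (@perm_inj _ s) e0) => e f /eqP <-.
  exact: (forallP s_ok).
Qed.

End Eulerian.

(** * Naturally labeled posets and their restrictions *)

Lemma eq_nlposet k (p q : nlposet k) : prec p =2 prec q -> p = q.
Proof.
by move=> eq_pq; apply: val_inj; apply/setP => -[a b]; apply: eq_pq.
Qed.

Lemma prec_ltn k (p : nlposet k) a b : prec p a b -> a < b.
Proof. by have /is_nlposetP[_ _] := nlsetP p; apply. Qed.

Lemma prec_trans k (p : nlposet k) : transitive (prec p).
Proof. by have /is_nlposetP[] := nlsetP p. Qed.

Lemma prec_drop_largest m (p : nlposet m.+1) (a b : 'I_m) :
  prec (drop_largest p) a b = prec p (lift ord_max a) (lift ord_max b).
Proof.
have low (c : 'I_m) : @keep_low m.+1 c = lift ord_max c.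
  exact/val_inj/esym/lift_max.
by rewrite -!low {1}/prec /label_rel inE.
Qed.

Lemma prec_drop_smallest m (p : nlposet m.+1) (a b : 'I_m) :
  prec (drop_smallest p) a b = prec p (lift ord0 a) (lift ord0 b).
Proof.
have high (c : 'I_m) : @keep_high m.+1 c = lift ord0 c by apply: val_inj.
by rewrite -!high {1}/prec /label_rel inE.
Qed.

(** * Adding a new largest label *)

Section AddLargest.

Variable m : nat.
Implicit Types (p q : nlposet m.+1) (mu : nlposet m) (D : {set 'I_m}).

Definition down_closed mu D : Prop :=
  forall a b, prec mu a b -> b \in D -> a \in D.

Definition add_largest_set mu D : {set 'I_m.+1 * 'I_m.+1} :=
  [set ab | match unlift ord_max ab.1, unlift ord_max ab.2 with
            | Some a, Some b => prec mu a b
            | Some a, None => a \in D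
            | None, _ => false
            end].

Lemma add_largest_subproof mu D :
  down_closed mu D -> is_nlposet (add_largest_set mu D).
Proof.
move=> downD; have /is_nlposetP[irr tr nat_mu] := nlsetP mu.
apply/is_nlposetP; rewrite /label_rel; split.
- by move=> a; rewrite inE /=; case: unliftP => // i _; apply: irr.
- move=> b a c; rewrite !inE /=.
  case: (unliftP _ a) => // i _; case: (unliftP _ b) => // j _.
  by case: (unliftP _ c) => [l|] _; [apply: tr | apply: downD].
- move=> a b; rewrite inE /=.
  case: (unliftP _ a) => // i ->; case: (unliftP _ b) => [j|] ->.
    by move/nat_mu; rewrite !lift_max.
  by rewrite lift_max /= ltn_ord.
Qed.

Definition add_largest mu D (downD : down_closed mu D) : nlposet m.+1 :=
  NLPoset (add_largest_subproof downD).

Lemma drop_add_largest mu D (downD : down_closed mu D) :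
  drop_largest (add_largest downD) = mu.
Proof.
apply: eq_nlposet => a b; rewrite prec_drop_largest.
by rewrite {1}/prec /label_rel inE /= !liftK.
Qed.

Lemma prec_add_largest_max mu D (downD : down_closed mu D) a :
  prec (add_largest downD) (lift ord_max a) ord_max = (a \in D).
Proof. by rewrite /prec /label_rel inE /= liftK unlift_none. Qed.

Definition not_above_smallest p : {set 'I_m} :=
  [set a | ~~ prec p ord0 (lift ord0 a)].

Lemma not_above_smallest_down p :
  down_closed (drop_smallest p) (not_above_smallest p).
Proof.
move=> a b; rewrite prec_drop_smallest !inE => ab.
by apply: contra => /prec_trans; apply.
Qed.

Definition replace_smallest p : nlposet m.+1 :=
  add_largest (@not_above_smallest_down p).

(** The labels other than the new largest one give back p^+, and those not
below it are the labels that were above the smallest label of p. *)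
Lemma replace_smallest_inj : injective replace_smallest.
Proof.
move=> p q pq.
have eq_high : drop_smallest p = drop_smallest q.
  rewrite -(drop_add_largest (@not_above_smallest_down p)).
  rewrite -(drop_add_largest (@not_above_smallest_down q)).
  by rewrite -!/(replace_smallest _) pq.
have eq_low : not_above_smallest p = not_above_smallest q.
  apply/setP => a.
  rewrite -(prec_add_largest_max (@not_above_smallest_down p)).
  rewrite -(prec_add_largest_max (@not_above_smallest_down q)).
  by rewrite -!/(replace_smallest _) pq.
apply: eq_nlposet => a b.
case: (unliftP ord0 b) => [j|] ->; last by apply/idP/idP => /prec_ltn.
case: (unliftP ord0 a) => [i|] ->.
  by rewrite -!prec_drop_smallest eq_high.
by have /setP/(_ j) := eq_low; rewrite !inE => /negb_inj.
Qed.

(** * Reaching the antichain *)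

Lemma antichain_subproof : is_nlposet (set0 : {set 'I_m.+1 * 'I_m.+1}).
Proof.
by apply/is_nlposetP; rewrite /label_rel; split=> [a|b a c|a b]; rewrite !inE.
Qed.

Definition antichain : nlposet m.+1 := NLPoset antichain_subproof.

Lemma down_closed0 mu : down_closed mu set0.
Proof. by move=> a b _; rewrite inE. Qed.

(** Replacing the smallest label by an isolated largest one lowers the labels
of every surviving related pair by one, so [n] such steps suffice. *)
Lemma connect_antichain n p :
    (forall a b, prec p a b -> b < n) ->
  connect (fun q r => drop_smallest q == drop_largest r) p antichain.
Proof.
elim: n p => [|n IH] p p_lt.
  rewrite (_ : p = antichain) //; apply: eq_nlposet => a b.
  by rewrite [RHS]inE; apply/negP => /p_lt.
pose q := add_largest (@down_closed0 (drop_smallest p)).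
apply: (@connect_trans _ _ q); first by apply: connect1; rewrite drop_add_largest.
apply: IH => a b; rewrite /q /prec /label_rel inE /=.
case: (unliftP _ a) => // i _; case: (unliftP _ b) => [j|] ->; last by rewrite inE.
rewrite lift_max -/(prec _ i j) prec_drop_smallest => /p_lt.
by rewrite lift0.
Qed.

End AddLargest.

Theorem mainTheorem1 (k : nat) (hk : 2 <= k) :
  exists s : seq (nlposet k), universal_cycle s.
Proof.
case: k hk => // m _.
apply: (@eulerian_circuit _ _ (@drop_largest m.+1) (@drop_smallest m.+1)
          (perm (@replace_smallest_inj m)) (antichain m)).
- by apply/forallP => p; rewrite permE drop_add_largest.
- by move=> p; apply: (@connect_antichain _ m.+1) => a b _.
Qed.
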